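(* Let $\mathfrak{M}=(\mathbf{M},\models,\mathcal{P}(\mathscr{L}))$ be a normal abstract model structure such that $\mathscr{L}$ is not satisfiable, and let $\tau_N$ be the topology on $\mathbf{M}$ generated by $\{\mathbf{M}\setminus\mathsf{Mod}(\{\alpha\})\mid\alpha\in\mathscr{L}\}$ as a subbase. Then $\mathfrak{M}$ is compact iff $(\mathbf{M},\tau_N)$ is a compact topological space.
   Context: An abstract model structure is a triple $(\mathbf{M},\models,\mathcal{P}(\mathscr{L}))$ with $\mathbf{M}\neq\emptyset$, $\mathscr{L}$ a set and $\models\,\subseteq\mathbf{M}\times\mathcal{P}(\mathscr{L})$. It is normal if for all $m$ and $\Gamma$: $m\models\Gamma$ iff $m\models\{\alpha\}$ for all $\alpha\in\Gamma$. $\mathsf{Mod}(\Gamma)=\{m\in\mathbf{M}\mid m\models\Gamma\}$. $\Gamma$ is satisfiable if $\mathsf{Mod}(\Gamma)\ne\emptyset$; finitely satisfiable if every finite subset is satisfiable; $\mathfrak{M}$ is compact if for all $\Gamma\subseteq\mathscr{L}$, $\Gamma$ is satisfiable iff it is finitely satisfiable. *)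

(* Defs.v *)
From HB Require Import structures.
From mathcomp Require Import all_boot.
From mathcomp Require Import boolp classical_sets functions cardinality.
From mathcomp Require Import topology.

Set Implicit Arguments.
Unset Strict Implicit.
Unset Printing Implicit Defensive.

Local Open Scope classical_set_scope.

(* The set of formulas L is a type, so that P(L) is [set formula] and L itself,
   as an element of P(L), is [setT]. *)
Record modelStructure := ModelStructure {
  model : Type;
  formula : Type;
  models : model -> set formula -> Prop;
  model_nonempty : [set: model] !=set0 }.

Section ModelStructure.
Variable S : modelStructure.
Implicit Types G : set (formula S).

Definition normal :=
  forall (m : model S) G, models m G <-> forall a, G a -> models m [set a].

Definition Mod G : set (model S) := [set m | models m G].

Definition satisfiable G := Mod G !=set0.

Definition finitely_satisfiable G :=
  forall G0, finite_set G0 -> G0 `<=` G -> satisfiable G0.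

Definition compact_structure :=
  forall G, satisfiable G <-> finitely_satisfiable G.

Definition tauN_subbase : set (set (model S)) :=
  [set ~` Mod [set a] | a in [set: formula S]].

(* An alias of [model S], to carry the topology generated by [tauN_subbase]. *)
Definition tauN : Type := model S.

HB.instance Definition _ := gen_eqMixin tauN.
HB.instance Definition _ := gen_choiceMixin tauN.
HB.instance Definition _ :=
  @isSubBaseTopological.Build tauN (set (model S)) tauN_subbase id.

End ModelStructure.

(* Main.v *)
(* Ultrafilters take the place of Alexander's subbase lemma.  If the structure
   is compact and F is an ultrafilter on M, then the formulas a with Mod a in F
   form a finitely satisfiable theory, and F converges to any model of it.
   Conversely, if tau_N is compact and G is finitely satisfiable, then the sets
   Mod G0, for G0 a finite part of G, form a filter base, and a cluster point of
   it is a model of G because each Mod a is closed. *)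
Require Import Defs.
From mathcomp Require Import all_boot.
From mathcomp Require Import boolp classical_sets functions cardinality.
From mathcomp Require Import filter topology.

Local Open Scope classical_set_scope.

Lemma open_setC_Mod1 (S : modelStructure) (a : formula S) :
  open (~` Mod [set a] : set (tauN S)).
Proof.
(* A union of one finite intersection with one factor. *)
exists [set ~` Mod [set a]]; last by rewrite bigcup_set1.
by move=> _ ->; apply: (@finI_from1 _ _ _ id); exists a.
Qed.

(** Every neighbourhood of [m] contains a finite intersection of subbasic sets through [m], and [F]
    is closed under finite intersections. *)
Lemma cvg_tauN (S : modelStructure) (F : set_system (tauN S)) (m : tauN S) :
    Filter F -> (forall a, ~ Mod [set a] m -> F (~` Mod [set a])) ->
  F --> m.
Proof.
move=> FF Fm A [B [[D sD <-] [C DC Cm] BA]].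
apply: filterS BA _; apply: (@filterS _ F _ C); first exact: bigcup_sup.
have [E sE EC] := sD C DC; move: Cm; rewrite -{}EC => Em.
apply: filter_bigI => i Ei.
have := sE i Ei; rewrite inE => -[a _ eai].
by move: (Em i Ei); rewrite -eai; exact: Fm.
Qed.

Section Normal.
Variables (S : modelStructure) (normalS : normal S).
Implicit Types G : set (formula S).

(** Normality enters the proof only through this identity. *)
Lemma Mod_bigcap G : Mod G = \bigcap_(a in G) Mod [set a].
Proof. by rewrite predeqE => m; exact: normalS. Qed.

Lemma subset_Mod G G' : G `<=` G' -> Mod G' `<=` Mod G.
Proof. by rewrite !Mod_bigcap => sGG' m mG' a /sGG'; exact: mG'. Qed.

Lemma ModU G G' : Mod (G `|` G') = Mod G `&` Mod G'.
Proof. by rewrite !Mod_bigcap bigcap_setU. Qed.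

Lemma filter_Mod (F : set_system (model S)) G : Filter F -> finite_set G ->
  (forall a, G a -> F (Mod [set a])) -> F (Mod G).
Proof.
(* The alias [{classic formula S}] supplies the choice structure that finite sets of formulas
   require. *)
move=> FF /(@finite_fsetP {classic formula S})[E GE] FG.
rewrite Mod_bigcap GE; apply: (@filter_bigI _ {classic formula S}) => // a Ea.
by apply: FG; rewrite GE.
Qed.

Lemma satisfiable_finitely G : satisfiable G -> finitely_satisfiable G.
Proof. by move=> [m mG] G0 _ /subset_Mod sG; exists m; exact: sG. Qed.

Lemma compact_structure_tauN : compact_structure S -> compact [set: tauN S].
Proof.
move=> coS; rewrite compact_ultra => F FU _.
have /coS[m mG] : finitely_satisfiable [set a | F (Mod [set a])].
  by move=> G0 finG0 sG0; apply: (@filter_ex _ F); exact: filter_Mod.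
exists m; split=> //; apply: cvg_tauN => a am.
(* If [Mod [set a]] were in [F], then [m] would be a model of [a]. *)
have [Fa|//] := in_ultra_setVsetC (Mod [set a]) FU.
by case: am; move: mG; rewrite Mod_bigcap; apply.
Qed.

Lemma tauN_compact_structure : compact [set: tauN S] -> compact_structure S.
Proof.
move=> coM G; split; first exact: satisfiable_finitely.
move=> fsG; pose D := [set G0 | finite_set G0 /\ G0 `<=` G].
have FF : ProperFilter (filter_from D (@Mod S)).
  apply: filter_from_proper; last by move=> G0 []; exact: fsG.
  apply: filter_from_filter; first by exists set0; split.
  move=> G0 G1 [fG0 sG0] [fG1 sG1]; exists (G0 `|` G1); last by rewrite ModU.
  by split; [rewrite finite_setU | rewrite subUset].
have [m [_ clm]] := coM _ FF filterT.
exists m; rewrite Mod_bigcap => a Ga; apply: contrapT => am.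
have Fa : filter_from D (@Mod S) (Mod [set a]).
  by exists [set a] => //; split=> // _ ->.
(* A neighbourhood of the cluster point [m] cannot miss [Mod [set a]], a member of the filter. *)
have [|x []//] := clm _ (~` Mod [set a]) Fa.
by apply: open_nbhs_nbhs; split=> //; exact: open_setC_Mod1.
Qed.

End Normal.

Theorem theorem3p25 (S : modelStructure) (normalS : normal S)
    (unsatL : ~ satisfiable [set: formula S]) :
  compact_structure S <-> compact [set: tauN S].
Proof.
by split; [exact: compact_structure_tauN | exact: tauN_compact_structure].
Qed.
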